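(* Let $\hbar=1$ and $i\in I$. The representation $\rho_i$ of the Cartan doubled Yangian $Y_\infty(\mathfrak g)$ on $W_\infty^{(i)}$ factorizes through the projection $\pi_{-\varpi_i^\vee}:Y_\infty(\mathfrak g)\to Y_{-\varpi_i^\vee}(\mathfrak g)$, and thus gives a $Y_{-\varpi_i^\vee}(\mathfrak g)$-module structure on $W_\infty^{(i)}$. (For $x\in\mathbb C$, the negative prefundamental module $L_{i,x}^-$ is defined to be the pullback of this $Y_{-\varpi_i^\vee}(\mathfrak g)$-module by the spectral parameter shift $\tau_x$.)
   Context: Lie data. $\mathfrak g$ is a finite-dimensional complex simple Lie algebra with Cartan subalgebra $\mathfrak h$, Dynkin nodes $I$, simple roots $\alpha_i\in\mathfrak h^*$, nondegenerate invariant symmetric form $(\,,\,)$ on $\mathfrak h^*$; $c_{ij}=2(\alpha_i,\alpha_j)/(\alpha_i,\alpha_i)$, $d_{ij}=(\alpha_i,\alpha_j)/2$, $d_i=d_{ii}\in\{1,2,3\}$ with greatest common divisor $1$. The fundamental coweights $\varpi_i^\vee\in\mathfrak h$ satisfy $\langle\varpi_i^\vee,\alpha_j\rangle=\delta_{ij}$; $\mathbf Q^\vee=\oplus_i\mathbb Z\varpi_i^\vee$ is the coweight lattice. Yangian (with $\hbar=1$). $Y_{\hbar=1}(\mathfrak g)$ is generated by $x_{i,n}^\pm,\xi_{i,n}$ ($i\in I$, $n\in\mathbb Z_{\ge0}$) with relations $[\xi_{i,m},\xi_{j,n}]=0$, $[\xi_{i,0},x_{j,n}^\pm]=\pm2d_{ij}x_{j,n}^\pm$,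 $[x_{i,m}^+,x_{j,n}^-]=\delta_{ij}\xi_{i,m+n}$, $[\xi_{i,m+1},x_{j,n}^\pm]-[\xi_{i,m},x_{j,n+1}^\pm]=\pm d_{ij}(\xi_{i,m}x_{j,n}^\pm+x_{j,n}^\pm\xi_{i,m})$, $[x_{i,m+1}^\pm,x_{j,n}^\pm]-[x_{i,m}^\pm,x_{j,n+1}^\pm]=\pm d_{ij}(x_{i,m}^\pm x_{j,n}^\pm+x_{j,n}^\pm x_{i,m}^\pm)$, and $\mathrm{ad}_{x_{i,0}^\pm}^{1-c_{ij}}(x_{j,n}^\pm)=0$ for $i\neq j$. Set $x_i^\pm(u)=\sum_{n\ge0}x_{i,n}^\pm u^{-n-1}$, $\xi_i(u)=1+\sum_{n\ge0}\xi_{i,n}u^{-n-1}$. It is a Hopf algebra with Drinfeld's coproduct: $x_{i,0}^\pm,\xi_{i,0}$ are primitive (and generate $U(\mathfrak g)$), and $\Delta(\xi_{i,1})=\xi_{i,1}\otimes1+1\otimes\xi_{i,1}+\xi_{i,0}\otimes\xi_{i,0}-\sum_{\alpha>0}(\alpha,\alpha_i)x_\alpha^-\otimes x_\alpha^+$, with $x_\alpha^\pm\in\mathfrak g_{\pm\alpha}$ root vectors with $(x_\alpha^+,x_\alpha^-)=1$. Shifted Yangians. The Cartan doubled Yangian $Y_\infty(\mathfrak g)$ is the algebra generated by $E_i^{(m)},F_i^{(m)},H_i^{(p)}$ ($i\in I$, $m\in\mathbb Z_{>0}$, $p\in\mathbb Z$) with relations $[H_i^{(p)},H_j^{(q)}]=0$,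 $[E_i^{(m)},F_j^{(n)}]=\delta_{ij}H_i^{(m+n-1)}$, $[H_i^{(p+1)},E_j^{(m)}]-[H_i^{(p)},E_j^{(m+1)}]=d_{ij}(H_i^{(p)}E_j^{(m)}+E_j^{(m)}H_i^{(p)})$, $[H_i^{(p+1)},F_j^{(m)}]-[H_i^{(p)},F_j^{(m+1)}]=-d_{ij}(H_i^{(p)}F_j^{(m)}+F_j^{(m)}H_i^{(p)})$, $[E_i^{(m+1)},E_j^{(n)}]-[E_i^{(m)},E_j^{(n+1)}]=d_{ij}(E_i^{(m)}E_j^{(n)}+E_j^{(n)}E_i^{(m)})$, $[F_i^{(m+1)},F_j^{(n)}]-[F_i^{(m)},F_j^{(n+1)}]=-d_{ij}(F_i^{(m)}F_j^{(n)}+F_j^{(n)}F_i^{(m)})$, $\mathrm{ad}_{E_i^{(1)}}^{1-c_{ij}}(E_j^{(m)})=0=\mathrm{ad}_{F_i^{(1)}}^{1-c_{ij}}(F_j^{(m)})$ for $i\ne j$. For $\mu\in\mathbf Q^\vee$ the shifted Yangian $Y_\mu(\mathfrak g)$ is the quotient of $Y_\infty(\mathfrak g)$ by the further relations $H_i^{(-\langle\mu,\alpha_i\rangle)}=1$ and $H_i^{(p)}=0$ for $p<-\langle\mu,\alpha_i\rangle$ ($i\in I$); $\pi_\mu:Y_\infty(\mathfrak g)\to Y_\mu(\mathfrak g)$ is the quotient map. Put $E_i(u)=\sum_{m\ge1}E_i^{(m)}u^{-m}$, $F_i(u)=\sum_{m\ge1}F_i^{(m)}u^{-m}$, $H_i(u)=\sum_{p\in\mathbb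 Z}H_i^{(p)}u^{-p}$. $\tau_x$ is the automorphism of $Y_\mu(\mathfrak g)$ given by $E_i(u)\mapsto E_i(u+x)$, $F_i(u)\mapsto F_i(u+x)$, $H_i(u)\mapsto H_i(u+x)$. Inductive system. Fix $i\in I$. For $k\in\mathbb Z_{\ge0}$, $x\in\mathbb C$, the Kirillov–Reshetikhin module $W_{k,x}^{(i)}$ is the finite-dimensional irreducible $Y_{\hbar=1}(\mathfrak g)$-module generated by a nonzero vector $\omega$ with $x_j^+(u)\omega=0$ and $\xi_j(u)\omega=\big(\frac{u+kd_i+x}{u+x}\big)^{\delta_{ij}}\omega$ for all $j\in I$ (such $\omega$ is called a highest $\ell$-weight vector). For integers $0\le l<k$ let $Z_{lk}=W_{k-l,ld_i}^{(i)}$ with fixed highest $\ell$-weight vector $\omega_{lk}$. For $m<l<k$ there is a unique module morphism $Z_{ml}\otimes Z_{lk}\to Z_{mk}$ with $\omega_{ml}\otimes\omega_{lk}\mapsto\omega_{mk}$; for $m=0$ call it $\mathscr F_{k,l}:W_{l,0}^{(i)}\otimes Z_{lk}\to W_{k,0}^{(i)}$, and put $F_{k,l}:W_{l,0}^{(i)}\to W_{k,0}^{(i)}$, $F_{k,l}(v)=\mathscr F_{k,l}(v\otimes\omega_{lk})$. The $F_{k,l}$ are injective and form an inductive system of vector spaces with inductive limit $W_\infty^{(i)}$. The representation $\rho_i$. For $l\in\mathbb C^\times$ there is an algebra morphism $\theta_{i,l}:Y_\infty(\mathfrak g)\to Y_{\hbar=1}(\mathfrak g)$, $E_j(u)\mapsto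 x_j^+(u)$, $F_j(u)\mapsto(\frac1{ld_i})^{\delta_{ij}}x_j^-(u)$, $H_j(u)\mapsto(\frac1{ld_i})^{\delta_{ij}}\xi_j(u)$. For $l\in\mathbb Z_{>0}$, view $W_{l,0}^{(i)}$ as a $Y_\infty(\mathfrak g)$-module via $\theta_{i,l}$. For each generator $t\in\{E_j^{(m)},F_j^{(m)},H_j^{(p)}\}$ and $l\in\mathbb Z_{>0}$ there are unique linear maps $C_t^l,D_t^l:W_{l,0}^{(i)}\to W_{l+1,0}^{(i)}$ with $tF_{k,l}=F_{k,l+1}(C_t^l+(kd_i)^{-1}D_t^l)$ for all $k>l+1$. They are morphisms of inductive systems; let $C_t$ be the inductive limit of the $C_t^l$, an endomorphism of $W_\infty^{(i)}$. Then $t\mapsto C_t$ defines the representation $\rho_i$ of $Y_\infty(\mathfrak g)$ on $W_\infty^{(i)}$. *)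

(* Defs.v *)
From HB Require Import structures.
From mathcomp Require Import all_boot all_order all_algebra.
From mathcomp Require Import boolp classical_sets fsbigop.
From mathcomp Require Import finmap monalg ring zify.

Set Implicit Arguments.
Unset Strict Implicit.
Unset Printing Implicit Defensive.

Import Order.TTheory GRing.Theory Num.Theory.
Local Open Scope ring_scope.

(* Unital associative algebras.  [algType] is not used because it requires
   [1 != 0], which is not known of an algebra given by generators and
   relations. *)
HB.mixin Record Lmodule_isAssocAlg (K : fieldType) A of GRing.Lmodule K A := {
  aone : A;
  amul : A -> A -> A;
  amulA : associative amul;
  amul1l : left_id aone amul;
  amul1r : right_id aone amul;
  amulPl : forall z, linear (amul^~ z);
  amulPr : forall x, linear (amul x)
}.

#[short(type="assocAlgType")]
HB.structure Definition AssocAlg (K : fieldType) :=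
  {A of GRing.Lmodule K A & Lmodule_isAssocAlg K A}.

Notation "x ** y" := (amul x y) (at level 40, left associativity) : ring_scope.

Section AssocAlgTheory.
Variables (K : fieldType) (A : assocAlgType K).
Implicit Types (a : K) (x y z : A).

Lemma amulDl z : {morph (@amul K A)^~ z : x y / x + y}.
Proof. by move=> x y; rewrite -[x]scale1r amulPl !scale1r. Qed.
Lemma amulDr x : {morph (@amul K A) x : y z / y + z}.
Proof. by move=> y z; rewrite -[y]scale1r amulPr !scale1r. Qed.
Lemma amul0l z : 0 ** z = 0 :> A.
Proof. by apply: (@addrI _ (0 ** z)); rewrite -amulDl !addr0. Qed.
Lemma amul0r x : x ** 0 = 0 :> A.
Proof. by apply: (@addrI _ (x ** 0)); rewrite -amulDr !addr0. Qed.
Lemma amulZl a x z : (a *: x) ** z = a *: (x ** z).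
Proof. by rewrite -[a *: x]addr0 amulPl amul0l addr0. Qed.
Lemma amulZr a x z : x ** (a *: z) = a *: (x ** z).
Proof. by rewrite -[a *: z]addr0 amulPr amul0r addr0. Qed.
Lemma amulNl x z : (- x) ** z = - (x ** z).
Proof. by rewrite -scaleN1r amulZl scaleN1r. Qed.
Lemma amulNr x z : x ** (- z) = - (x ** z).
Proof. by rewrite -scaleN1r amulZr scaleN1r. Qed.

Definition comm x y := x ** y - y ** x.
Definition acomm x y := x ** y + y ** x.

End AssocAlgTheory.

Definition alg_morphism (K : fieldType) (A B : assocAlgType K) (f : A -> B) :=
  [/\ linear f, f aone = aone & {morph f : x y / x ** y}].

Definition is_repr (K : fieldType) (A : assocAlgType K) (V : lmodType K)
    (act : A -> V -> V) :=
  [/\ forall v, linear (act^~ v), forall x, linear (act x),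
      forall v, act aone v = v &
      forall x y v, act (x ** y) v = act x (act y v)].

Lemma linear_at0 (K : fieldType) (V W : lmodType K) (f : V -> W) :
  linear f -> f 0 = 0.
Proof. by move=> /(_ (-1) 0 0); rewrite scaler0 addr0 scaleN1r addNr. Qed.

Lemma scale_addACA (K : fieldType) (V : lmodType K) (a c : K) (x y z t : V) :
  c *: (a *: x + y) + (a *: z + t) = a *: (c *: x + z) + (c *: y + t).
Proof. by rewrite !scalerDr !scalerA addrACA [c * a]mulrC. Qed.

Lemma alg_morphism0 (K : fieldType) (A B : assocAlgType K) (f : A -> B) :
  alg_morphism f -> f 0 = 0.
Proof. by case=> fP _ _; exact: linear_at0 fP. Qed.

Lemma alg_morphismZ (K : fieldType) (A B : assocAlgType K) (f : A -> B) :
  alg_morphism f -> forall a x, f (a *: x) = a *: f x.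
Proof.
move=> fm a x; have [fP _ _] := fm.
by rewrite -[a *: x]addr0 fP alg_morphism0 // addr0.
Qed.

Lemma alg_morphismB (K : fieldType) (A B : assocAlgType K) (f : A -> B) :
  alg_morphism f -> {morph f : x y / x - y}.
Proof.
by move=> [fP _ _] x y; rewrite addrC -scaleN1r fP scaleN1r addrC.
Qed.

Lemma alg_morphism_comm (K : fieldType) (A B : assocAlgType K) (f : A -> B) :
  alg_morphism f -> {morph f : x y / comm x y}.
Proof.
move=> [fP _ fM] x y; rewrite /comm -scaleN1r addrC fP !fM scaleN1r.
by rewrite addrC.
Qed.

Lemma alg_morphism_acomm (K : fieldType) (A B : assocAlgType K) (f : A -> B) :
  alg_morphism f -> {morph f : x y / acomm x y}.
Proof.
by move=> [fP _ fM] x y; rewrite /acomm -[x ** y]scale1r fP !fM scale1r.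
Qed.

Lemma commZl (K : fieldType) (A : assocAlgType K) a (x y : A) :
  comm (a *: x) y = a *: comm x y.
Proof. by rewrite /comm amulZl amulZr scalerBr. Qed.

Lemma commZr (K : fieldType) (A : assocAlgType K) a (x y : A) :
  comm x (a *: y) = a *: comm x y.
Proof. by rewrite /comm amulZl amulZr scalerBr. Qed.

Lemma acommZl (K : fieldType) (A : assocAlgType K) a (x y : A) :
  acomm (a *: x) y = a *: acomm x y.
Proof. by rewrite /acomm amulZl amulZr scalerDr. Qed.

Lemma acommZr (K : fieldType) (A : assocAlgType K) a (x y : A) :
  acomm x (a *: y) = a *: acomm x y.
Proof. by rewrite /acomm amulZl amulZr scalerDr. Qed.

Lemma comm0l (K : fieldType) (A : assocAlgType K) (y : A) : comm 0 y = 0.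
Proof. by rewrite /comm amul0l amul0r subrr. Qed.

Lemma comm0r (K : fieldType) (A : assocAlgType K) (x : A) : comm x 0 = 0.
Proof. by rewrite /comm amul0l amul0r subrr. Qed.

Lemma comm1l (K : fieldType) (A : assocAlgType K) (y : A) : comm aone y = 0.
Proof. by rewrite /comm amul1l amul1r subrr. Qed.

Lemma iter_comm_scale (K : fieldType) (A : assocAlgType K) a b (x y : A) n :
  iter n (comm (a *: x)) (b *: y) = (a ^+ n * b) *: iter n (comm x) y.
Proof.
elim: n => [|n ih]; first by rewrite mul1r.
by rewrite !iterS ih commZl commZr scalerA mulrA -exprS.
Qed.

Lemma alg_morphism_iter_comm (K : fieldType) (A B : assocAlgType K)
    (f : A -> B) : alg_morphism f ->
  forall n x y, f (iter n (comm x) y) = iter n (comm (f x)) (f y).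
Proof.
by move=> fm n x y; elim: n => // n ih; rewrite !iterS alg_morphism_comm // ih.
Qed.

Section ModuleQuotient.
Variables (K : fieldType) (V : lmodType K).

Fact submod_oppr_closed (N : submodClosed V) : oppr_closed N.
Proof. by move=> x xN; rewrite -scaleN1r rpredZ. Qed.

Definition submod_zmod (N : submodClosed V) : zmodClosed V :=
  HB.pack_for (zmodClosed V) (GRing.SubmodClosed.sort N)
    (GRing.isOppClosed.Build V (GRing.SubmodClosed.sort N)
      (@submod_oppr_closed N)).

Definition lquot (N : submodClosed V) := Quotient.quot (submod_zmod N).

Variable N : submodClosed V.
HB.instance Definition _ := GRing.Zmodule.on (lquot N).

Definition lproj (x : V) : lquot N := \pi_(Quotient.quot (submod_zmod N))%qT x.
Definition lrepr (q : lquot N) : V := repr q.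

Lemma lproj_eq x y : lproj x = lproj y <-> x - y \in N.
Proof.
by rewrite /lproj; split=> [/eqP|h]; [|apply/eqP]; rewrite -Quotient.idealrBE.
Qed.

Lemma lreprK (q : lquot N) : lproj (lrepr q) = q.
Proof. exact: reprK. Qed.

Definition lquot_scale (a : K) (q : lquot N) := lproj (a *: lrepr q).

Fact lprojZ_subproof a x : lquot_scale a (lproj x) = lproj (a *: x).
Proof.
apply/lproj_eq; rewrite -scalerBr rpredZ //.
by apply/lproj_eq; rewrite lreprK.
Qed.

Lemma lproj0 : lproj 0 = 0. Proof. exact: raddf0. Qed.
Lemma lprojD : {morph lproj : x y / x + y}.
Proof. exact: raddfD. Qed.

Fact lquot_scaleA a b q :
  lquot_scale a (lquot_scale b q) = lquot_scale (a * b) q.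
Proof. by rewrite -[q]lreprK !lprojZ_subproof scalerA. Qed.
Fact lquot_scale1 : left_id 1 lquot_scale.
Proof. by move=> q; rewrite -[q]lreprK lprojZ_subproof scale1r. Qed.
Fact lquot_scaleDr : right_distributive lquot_scale +%R.
Proof.
move=> a p q; rewrite -[p]lreprK -[q]lreprK -lprojD !lprojZ_subproof.
by rewrite scalerDr lprojD.
Qed.
Fact lquot_scaleDl q : {morph lquot_scale^~ q : a b / a + b}.
Proof. by move=> a b; rewrite -[q]lreprK !lprojZ_subproof scalerDl lprojD. Qed.

HB.instance Definition _ := GRing.Zmodule_isLmodule.Build K (lquot N)
  lquot_scaleA lquot_scale1 lquot_scaleDr lquot_scaleDl.

Lemma lproj_linear : linear lproj.
Proof. by move=> a x y; rewrite lprojD -lprojZ_subproof. Qed.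

HB.instance Definition _ :=
  GRing.isLinear.Build K V (lquot N) _ lproj lproj_linear.

End ModuleQuotient.

(* A quotient of [V] by the submodule [N]; the section [mq_repr] comes from
   choice. *)
Record module_quotient (K : fieldType) (V : lmodType K) (N : V -> Prop) :=
  ModuleQuotient {
    mq_carrier :> lmodType K;
    mq_proj : {linear V -> mq_carrier};
    mq_repr : mq_carrier -> V;
    mq_reprK : cancel mq_repr mq_proj;
    mq_ker : forall x, mq_proj x = 0 <-> N x
  }.

Record algebra_quotient (K : fieldType) (A : assocAlgType K) (J : A -> Prop) :=
  AlgebraQuotient {
    aq_carrier :> assocAlgType K;
    aq_proj : A -> aq_carrier;
    aq_repr : aq_carrier -> A;
    aq_proj_morphism : alg_morphism aq_proj;
    aq_reprK : cancel aq_repr aq_proj;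
    aq_ker : forall x, aq_proj x = 0 <-> J x
  }.

(* [R l r] is the relation [l = r]. *)
Section ModulePresentation.
Variables (K : fieldType) (V : lmodType K) (R : V -> V -> Prop).

Inductive rel_span : V -> Prop :=
| rel_span_rel l r of R l r : rel_span (l - r)
| rel_span0 : rel_span 0
| rel_spanP a x y of rel_span x & rel_span y : rel_span (a *: x + y).

Let rel_submod : {pred V} := fun x => `[< rel_span x >].

Let rel_submod_closed : submod_closed rel_submod.
Proof.
split=> [|a x y /asboolP hx /asboolP hy]; apply/asboolP.
  exact: rel_span0.
exact: rel_spanP.
Qed.

HB.instance Definition _ := GRing.isSubmodClosed.Build K V rel_submod
  rel_submod_closed.

Fact pres_mod_quotient : module_quotient rel_span.
Proof.
apply: (@ModuleQuotient _ _ _ (lquot rel_submod) (@lproj K V rel_submod)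
  (@lrepr K V rel_submod)) => [q|x]; first exact: lreprK.
rewrite -(lproj0 rel_submod) lproj_eq subr0.
by split=> [/asboolP|h] //; apply/asboolP.
Qed.

Definition pres_mod : lmodType K := pres_mod_quotient.
Definition pres_proj : {linear V -> pres_mod} := mq_proj pres_mod_quotient.

Lemma pres_proj_rel l r : R l r -> pres_proj l = pres_proj r.
Proof.
move=> h; apply/eqP; rewrite -subr_eq0 -linearB; apply/eqP/mq_ker.
exact: rel_span_rel.
Qed.

Lemma pres_reprK : cancel (@mq_repr _ _ _ pres_mod_quotient) pres_proj.
Proof. exact: mq_reprK. Qed.

Section Lift.
Variables (W : lmodType K) (f : V -> W).

Definition pres_lift (q : pres_mod) : W := f (mq_repr q).

Hypotheses (f_lin : linear f) (f_rel : forall l r, R l r -> f l = f r).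

Lemma pres_liftE x : pres_lift (pres_proj x) = f x.
Proof.
rewrite /pres_lift; set y := mq_repr _.
pose g := GRing.isLinear.Build K V W _ f f_lin.
pose fL : {linear V -> W} := HB.pack f g.
have h : rel_span (x - y).
  by apply/(mq_ker pres_mod_quotient); rewrite linearB /= mq_reprK subrr.
suff: fL (x - y) = 0.
  by move/eqP; rewrite linearB subr_eq0 => /eqP.
elim: h => [l r /f_rel h| | a u v _ hu _ hv].
- by rewrite linearB /= h subrr.
- exact: linear0.
- by rewrite linearP hu hv scaler0 addr0.
Qed.

Lemma pres_lift_linear : linear pres_lift.
Proof.
move=> a p q; rewrite -[p]pres_reprK -[q]pres_reprK -linearP.
by rewrite !pres_liftE f_lin.
Qed.

End Lift.
End ModulePresentation.

Section AlgebraPresentation.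
Variables (K : fieldType) (A : assocAlgType K) (R : A -> A -> Prop).

Inductive rel_ideal : A -> Prop :=
| rel_ideal_rel l r of R l r : rel_ideal (l - r)
| rel_ideal0 : rel_ideal 0
| rel_idealP a x y of rel_ideal x & rel_ideal y : rel_ideal (a *: x + y)
| rel_idealMl x y of rel_ideal y : rel_ideal (x ** y)
| rel_idealMr x y of rel_ideal x : rel_ideal (x ** y).

Section Construction.

Let rel_ideal_pred : {pred A} := fun x => `[< rel_ideal x >].

Let rel_ideal_closed : submod_closed rel_ideal_pred.
Proof.
split=> [|a x y /asboolP hx /asboolP hy]; apply/asboolP.
  exact: rel_ideal0.
exact: rel_idealP.
Qed.

HB.instance Definition _ := GRing.isSubmodClosed.Build K A rel_ideal_pred
  rel_ideal_closed.

Local Notation Q := (lquot rel_ideal_pred).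
Let pr : A -> Q := @lproj K A rel_ideal_pred.
Let rp : Q -> A := @lrepr K A rel_ideal_pred.
Let rpK : cancel rp pr. Proof. exact: lreprK. Qed.
Let prP : linear pr. Proof. exact: lproj_linear. Qed.
Let qmul (p q : Q) : Q := pr (rp p ** rp q).

Let prM x y : pr (x ** y) = qmul (pr x) (pr y).
Proof.
apply/lproj_eq; set x' := rp _; set y' := rp _.
have hx : x - x' \in rel_ideal_pred by apply/lproj_eq; rewrite lreprK.
have hy : y - y' \in rel_ideal_pred by apply/lproj_eq; rewrite lreprK.
rewrite -[x ** y](subrK (x' ** y)) -addrA -amulNl -amulDl -amulNr -amulDr.
by rewrite rpredD //; apply/asboolP; [apply: rel_idealMr|apply: rel_idealMl];
  apply/asboolP.
Qed.

Let qmulA : associative qmul.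
Proof. by move=> p q r; rewrite -[p]rpK -[q]rpK -[r]rpK -!prM amulA. Qed.
Let qmul1l : left_id (pr aone) qmul.
Proof. by move=> p; rewrite -[p]rpK -prM amul1l. Qed.
Let qmul1r : right_id (pr aone) qmul.
Proof. by move=> p; rewrite -[p]rpK -prM amul1r. Qed.
Let qmulPl q : linear (qmul^~ q).
Proof.
by move=> a x y; rewrite -[x]rpK -[y]rpK -[q]rpK -prP -!prM amulPl prP.
Qed.
Let qmulPr p : linear (qmul p).
Proof.
by move=> a x y; rewrite -[x]rpK -[y]rpK -[p]rpK -prP -!prM amulPr prP.
Qed.

Fact pres_alg_quotient : algebra_quotient rel_ideal.
Proof.
pose m := Lmodule_isAssocAlg.Build K Q qmulA qmul1l qmul1r qmulPl qmulPr.
pose QA : assocAlgType K := HB.pack Q m.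
apply: (@AlgebraQuotient _ _ _ QA pr rp) => [||x].
- by split; [exact: prP | | exact: prM].
- exact: rpK.
rewrite -(lproj0 rel_ideal_pred) lproj_eq subr0.
by split=> [/asboolP|h] //; apply/asboolP.
Qed.

End Construction.

Definition pres_alg : assocAlgType K := pres_alg_quotient.
Definition alg_proj : A -> pres_alg := @aq_proj _ _ _ pres_alg_quotient.

Lemma alg_proj_morphism : alg_morphism alg_proj.
Proof. exact: aq_proj_morphism. Qed.

HB.instance Definition _ := GRing.isLinear.Build K A pres_alg _ alg_proj
  (let: And3 h _ _ := alg_proj_morphism in h).

Lemma alg_projM : {morph alg_proj : x y / x ** y}.
Proof. by case: alg_proj_morphism. Qed.

Lemma alg_proj1 : alg_proj aone = aone.
Proof. by case: alg_proj_morphism. Qed.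

Lemma alg_reprK : cancel (@aq_repr _ _ _ pres_alg_quotient) alg_proj.
Proof. exact: aq_reprK. Qed.

Lemma alg_proj_rel l r : R l r -> alg_proj l = alg_proj r.
Proof.
move=> h; apply/eqP; rewrite -subr_eq0 -linearB; apply/eqP/aq_ker.
exact: rel_ideal_rel.
Qed.

Section Lift.
Variables (B : assocAlgType K) (f : A -> B).

Definition alg_lift (q : pres_alg) : B := f (aq_repr q).

Hypotheses (f_mor : alg_morphism f) (f_rel : forall l r, R l r -> f l = f r).

Lemma alg_liftE x : alg_lift (alg_proj x) = f x.
Proof.
rewrite /alg_lift; set y := aq_repr _; have [f_lin _ fM] := f_mor.
pose g := GRing.isLinear.Build K A B _ f f_lin.
pose fL : {linear A -> B} := HB.pack f g.
have h : rel_ideal (x - y).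
  apply/(aq_ker pres_alg_quotient).
  by rewrite -/alg_proj linearB /= /y alg_reprK subrr.
suff: fL (x - y) = 0.
  by move/eqP; rewrite linearB subr_eq0 => /eqP.
elim: h => [l r /f_rel h| | a u v _ hu _ hv | u v _ h | u v _ h].
- by rewrite linearB /= h subrr.
- exact: linear0.
- by rewrite linearP hu hv scaler0 addr0.
- by rewrite /= fM [f v]h amul0r.
- by rewrite /= fM [f u]h amul0l.
Qed.

Lemma alg_lift_morphism : alg_morphism alg_lift.
Proof.
have [f_lin f1 fM] := f_mor; split.
- move=> a p q; rewrite -[p]alg_reprK -[q]alg_reprK -linearP.
  by rewrite !alg_liftE f_lin.
- by rewrite -alg_proj1 alg_liftE.
- move=> p q; rewrite -[p]alg_reprK -[q]alg_reprK.
  by rewrite -alg_projM !alg_liftE fM.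
Qed.

End Lift.
End AlgebraPresentation.

Section FreeModule.
Variables (K : fieldType) (X : choiceType) (W : lmodType K) (f : X -> W).

Definition free_lift (g : {malg K[X]}) : W := \sum_(k <- msupp g) g@_k *: f k.

Lemma free_liftE (d : {fset X}) g : (msupp g `<=` d)%fset ->
  free_lift g = \sum_(k <- d) g@_k *: f k.
Proof.
move=> h; rewrite /free_lift; rewrite (big_fset_incl _ h) //.
by move=> x _ /mcoeff_outdom ->; rewrite scale0r.
Qed.

Lemma free_lift_linear : linear free_lift.
Proof.
move=> a g h; set d := (msupp g `|` msupp h `|` msupp (a *: g + h))%fset.
have dg : (msupp g `<=` d)%fset by apply/fsubsetP => x; rewrite !inE => ->.
have dh : (msupp h `<=` d)%fset.
  by apply/fsubsetP => x; rewrite !inE => ->; rewrite orbT.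
have dgh : (msupp (a *: g + h) `<=` d)%fset.
  by apply/fsubsetP => x; rewrite in_fsetU => ->; rewrite orbT.
rewrite (free_liftE dg) (free_liftE dh) (free_liftE dgh).
rewrite scaler_sumr -big_split /=; apply: eq_bigr => k _.
by rewrite mcoeffD mcoeffZ scalerDl scalerA.
Qed.

HB.instance Definition _ :=
  GRing.isLinear.Build K {malg K[X]} W _ free_lift free_lift_linear.

Lemma free_liftUc a k : free_lift << a *g k >> = a *: f k.
Proof.
rewrite (@free_liftE [fset k]%fset) ?msuppU_le //.
by rewrite big_seq_fset1 mcoeffUU.
Qed.

Lemma free_liftU k : free_lift << k >> = f k.
Proof. by rewrite free_liftUc scale1r. Qed.

End FreeModule.

Section MonoidAlgebra.
Variables (K : fieldType) (M : monomType).
Implicit Types (x y z : {malg K[M]}).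

Fact malg_mulPl z : linear (fun x => x * z).
Proof. by move=> a x y; rewrite mulrDl scalerAl. Qed.

Fact malg_mulPr x : linear (fun y => x * y).
Proof.
move=> a y z; rewrite mulrDr; congr (_ + _).
rewrite (malgMEw (fsubset_refl _) (msuppZ_le a y)) malgME scaler_sumr.
apply: eq_bigr => k _; rewrite scaler_sumr; apply: eq_bigr => l _.
apply/malgP => m; rewrite !mcoeffZ !mcoeffU mulrnAr.
by rewrite mulrCA.
Qed.

HB.instance Definition _ := Lmodule_isAssocAlg.Build K {malg K[M]}
  (@mulrA {malg K[M]}) (@mul1r _) (@mulr1 _) malg_mulPl malg_mulPr.

End MonoidAlgebra.

Section FreeAlgebra.
Variables (K : fieldType) (X : choiceType).

Definition free_alg := {malg K[{fmonom X}]}.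
HB.instance Definition _ := AssocAlg.on free_alg.

Definition free_gen (x : X) : free_alg := << fmu x >>.

Variables (B : assocAlgType K) (f : X -> B).

Definition word_eval (s : seq X) : B := foldr (fun x b => f x ** b) aone s.

Lemma word_eval_cat s t : word_eval (s ++ t) = word_eval s ** word_eval t.
Proof. by elim: s => [|x s /= ->]; rewrite ?amul1l ?amulA. Qed.

Definition free_alg_lift : free_alg -> B :=
  free_lift (fun m : {fmonom X} => word_eval m).

Lemma free_alg_liftE x : free_alg_lift (free_gen x) = f x.
Proof. by rewrite /free_alg_lift free_liftU fmU /= amul1r. Qed.

Lemma free_alg_lift_morphism : alg_morphism free_alg_lift.
Proof.
split; first exact: free_lift_linear.
- by rewrite [LHS]free_liftU fm1.
- move=> x y; rewrite [x ** y]malgME /free_alg_lift.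
  rewrite linear_sum [free_lift _ x]/free_lift.
  rewrite (big_morph _ (amulDl _) (amul0l _)); apply: eq_bigr => k _.
  rewrite linear_sum [free_lift _ y]/free_lift.
  rewrite (big_morph _ (amulDr _) (amul0r _)); apply: eq_bigr => l _.
  by rewrite /= free_liftUc fmM word_eval_cat amulZl amulZr scalerA.
Qed.

End FreeAlgebra.

Section Tensor.
Variables (K : fieldType) (U V : lmodType K).

Local Notation pure u v := (<< (u, v) >> : {malg K[(U * V)%type]}).

Inductive tensor_rel :
  {malg K[(U * V)%type]} -> {malg K[(U * V)%type]} -> Prop :=
| tensor_Pl a u u' v :
    tensor_rel (pure (a *: u + u') v) (a *: pure u v + pure u' v)
| tensor_Pr a u v v' :
    tensor_rel (pure u (a *: v + v')) (a *: pure u v + pure u v').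

Definition tensor : lmodType K := pres_mod tensor_rel.

Definition tens (u : U) (v : V) : tensor := pres_proj tensor_rel (pure u v).

Lemma tensPl v : linear (tens^~ v).
Proof.
move=> a u u'; rewrite /tens -linearP; apply: pres_proj_rel.
exact: tensor_Pl.
Qed.

Lemma tensPr u : linear (tens u).
Proof.
move=> a v v'; rewrite /tens -linearP; apply: pres_proj_rel.
exact: tensor_Pr.
Qed.

Lemma tensor_ind (P : tensor -> Prop) :
  P 0 -> (forall a s t, P s -> P t -> P (a *: s + t)) ->
  (forall u v, P (tens u v)) -> forall t, P t.
Proof.
move=> P0 PP Pt t; rewrite -[t]pres_reprK.
rewrite [mq_repr t]monalgE linear_sum; elim/big_ind: _ => //.
  by move=> x y Px Py; rewrite -[x]scale1r; apply: PP.
move=> [u v] _; set c := _@_ _.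
have -> : << c *g (u, v) >> = c *: pure u v.
  by apply/malgP => k; rewrite mcoeffZ !mcoeffU mulrnAr mulr1.
by rewrite -[_ *: _]addr0 linearP linear0; apply: PP => //; apply: Pt.
Qed.

Section Lift.
Variables (W : lmodType K) (B : U -> V -> W).

Definition tensor_lift : tensor -> W :=
  pres_lift (free_lift (fun p : (U * V)%type => B p.1 p.2)).

Hypotheses (BPl : forall v, linear (B^~ v)) (BPr : forall u, linear (B u)).

Fact tensor_lift_rel l r : tensor_rel l r ->
  free_lift (fun p : (U * V)%type => B p.1 p.2) l =
  free_lift (fun p : (U * V)%type => B p.1 p.2) r.
Proof.
by case=> *; rewrite linearP /= !free_liftU /= ?BPl ?BPr.
Qed.

Lemma tensor_liftE u v : tensor_lift (tens u v) = B u v.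
Proof.
rewrite [LHS]pres_liftE ?free_liftU //; first exact: free_lift_linear.
exact: tensor_lift_rel.
Qed.

Lemma tensor_lift_linear : linear tensor_lift.
Proof.
by apply: pres_lift_linear; [exact: free_lift_linear|exact: tensor_lift_rel].
Qed.

End Lift.
End Tensor.
Arguments tens {K U V}.

Section TensorAction.
Variables (K : fieldType) (A B V W : lmodType K).
Variables (f : A -> V -> V) (g : B -> W -> W).

(* The action of [A (x) B] on [V (x) W] with
   $(x \otimes y)(v \otimes w) = xv \otimes yw$. *)
Definition tensor_act (q : tensor A B) (t : tensor V W) : tensor V W :=
  tensor_lift (fun x y => tensor_lift (fun v w => tens (f x v) (g y w)) t) q.

Hypotheses (fPl : forall v, linear (f^~ v)) (fPr : forall x, linear (f x)).
Hypotheses (gPl : forall w, linear (g^~ w)) (gPr : forall y, linear (g y)).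

Let innerPl x y w : linear (fun v => tens (f x v) (g y w)).
Proof. by move=> a v v'; rewrite fPr tensPl. Qed.
Let innerPr x y v : linear (fun w => tens (f x v) (g y w)).
Proof. by move=> a w w'; rewrite gPr tensPr. Qed.
Let inner_lin x y : linear (tensor_lift (fun v w => tens (f x v) (g y w))).
Proof. exact: tensor_lift_linear (innerPl x y) (innerPr x y). Qed.

Let outerPl t y :
  linear (fun x => tensor_lift (fun v w => tens (f x v) (g y w)) t).
Proof.
move=> a x x'; elim/tensor_ind: t => [|c s t hs ht|v w].
- have h z : tensor_lift (fun v w => tens (f z v) (g y w)) 0 = 0.
    exact: linear_at0 (inner_lin _ _).
  by rewrite !h scaler0 addr0.
- by rewrite 3!(inner_lin _ _ c s t) hs ht; exact: scale_addACA.
- by rewrite !tensor_liftE // fPl tensPl.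
Qed.

Let outerPr t x :
  linear (fun y => tensor_lift (fun v w => tens (f x v) (g y w)) t).
Proof.
move=> a y y'; elim/tensor_ind: t => [|c s t hs ht|v w].
- have h z : tensor_lift (fun v w => tens (f x v) (g z w)) 0 = 0.
    exact: linear_at0 (inner_lin _ _).
  by rewrite !h scaler0 addr0.
- by rewrite 3!(inner_lin _ _ c s t) hs ht; exact: scale_addACA.
- by rewrite !tensor_liftE // gPl tensPr.
Qed.

Lemma tensor_actE x y v w :
  tensor_act (tens x y) (tens v w) = tens (f x v) (g y w).
Proof.
rewrite /tensor_act (tensor_liftE (outerPl _) (outerPr _)).
exact: tensor_liftE (innerPl _ _) (innerPr _ _) _ _.
Qed.

Lemma tensor_actPl t : linear (tensor_act^~ t).
Proof. exact: tensor_lift_linear (outerPl t) (outerPr t). Qed.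

Lemma tensor_actPr q : linear (tensor_act q).
Proof.
move=> a s t; elim/tensor_ind: q => [|c p q hp hq|x y].
- have h r : tensor_act 0 r = 0.
    exact: linear_at0 (tensor_actPl r).
  by rewrite !h scaler0 addr0.
- rewrite 3!(tensor_actPl _ c p q) hp hq; exact: scale_addACA.
- rewrite /tensor_act 3!(tensor_liftE (outerPl _) (outerPr _)).
  exact: inner_lin.
Qed.

End TensorAction.

Definition assoc_pack (K : fieldType) (M : lmodType K)
  (m : Lmodule_isAssocAlg K M) : assocAlgType K :=
  HB.pack (GRing.Lmodule.sort M) m.

Section TensorAlgebra.
Variables (K : fieldType) (A B : assocAlgType K).

Definition tensor_mul : tensor A B -> tensor A B -> tensor A B :=
  tensor_act (@amul K A) (@amul K B).

Lemma tensor_mulE x y x' y' :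
  tensor_mul (tens x y) (tens x' y') = tens (x ** x') (y ** y').
Proof. exact: (tensor_actE amulPl amulPr amulPl amulPr). Qed.

Lemma tensor_mulPl t : linear (tensor_mul^~ t).
Proof. exact: (tensor_actPl amulPl amulPr amulPl amulPr). Qed.

Lemma tensor_mulPr t : linear (tensor_mul t).
Proof. exact: (tensor_actPr amulPl amulPr amulPl amulPr). Qed.

Let tensor_mul0 :
  (forall t, tensor_mul 0 t = 0) * (forall t, tensor_mul t 0 = 0).
Proof.
split=> t; first exact: linear_at0 (tensor_mulPl t).
exact: linear_at0 (tensor_mulPr t).
Qed.

Fact tensor_mulA : associative tensor_mul.
Proof.
move=> p q r; elim/tensor_ind: p => [|a s t hs ht|x y].
- by rewrite !tensor_mul0.
- by rewrite 2!(tensor_mulPl _ a s t) (tensor_mulPl r a) hs ht.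
elim/tensor_ind: q => [|a s t hs ht|x' y'].
- by rewrite !tensor_mul0.
- rewrite (tensor_mulPl _ a s t) 2!(tensor_mulPr _ a) hs ht.
  by rewrite (tensor_mulPl r a).
elim/tensor_ind: r => [|a s t hs ht|x'' y''].
- by rewrite !tensor_mul0.
- by rewrite 3!(tensor_mulPr _ a) hs ht.
- by rewrite !tensor_mulE !amulA.
Qed.

Fact tensor_mul1l : left_id (tens aone aone) tensor_mul.
Proof.
move=> p.
elim/tensor_ind: p => [|a s t hs ht|x y]; first by rewrite !tensor_mul0.
- by rewrite (tensor_mulPr _ a) hs ht.
- by rewrite tensor_mulE !amul1l.
Qed.

Fact tensor_mul1r : right_id (tens aone aone) tensor_mul.
Proof.
move=> p.
elim/tensor_ind: p => [|a s t hs ht|x y]; first by rewrite !tensor_mul0.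
- by rewrite (tensor_mulPl _ a) hs ht.
- by rewrite tensor_mulE !amul1r.
Qed.

Definition tensor_alg : assocAlgType K :=
  assoc_pack (Lmodule_isAssocAlg.Build K (tensor A B)
    tensor_mulA tensor_mul1l tensor_mul1r tensor_mulPl tensor_mulPr).

End TensorAlgebra.

(* The inductive limit of the [W n] along [f m n : W m -> W n] for [m < n]. *)
Section DirectLimit.
Variables (K : fieldType) (W : nat -> lmodType K).
Variable f : forall m n, W m -> W n.

Local Notation pt n w :=
  (<< existT (fun n => W n : choiceType) n w >> :
     {malg K[{n : nat & (W n : choiceType)}]}).

Inductive dirlim_rel :
  {malg K[{n : nat & (W n : choiceType)}]} ->
  {malg K[{n : nat & (W n : choiceType)}]} -> Prop :=
| dirlim_linear n a (w w' : W n) :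
    dirlim_rel (pt n (a *: w + w')) (a *: pt n w + pt n w')
| dirlim_transition m n (w : W m) of (m < n)%N :
    dirlim_rel (pt n (f n w)) (pt m w).

Definition dirlim : lmodType K := pres_mod dirlim_rel.

Definition dirlim_in n (w : W n) : dirlim := pres_proj dirlim_rel (pt n w).

Lemma dirlim_in_linear n : linear (@dirlim_in n).
Proof.
move=> a w w'; rewrite /dirlim_in -linearP; apply: pres_proj_rel.
exact: dirlim_linear.
Qed.

Lemma dirlim_in_transition m n (w : W m) : (m < n)%N ->
  dirlim_in (f n w) = dirlim_in w.
Proof. by move=> h; apply: pres_proj_rel; apply: dirlim_transition. Qed.

End DirectLimit.

Section LieAlgebra.
Variables (K : fieldType) (g : vectType K) (br : g -> g -> g).

Definition lie_bracket :=
  [/\ forall y, linear (br^~ y), forall x, linear (br x),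
      forall x, br x x = 0 &
      forall x y z, br x (br y z) + br y (br z x) + br z (br x y) = 0].

Definition simple_bracket :=
  (exists x y, br x y != 0) /\
  forall U : {vspace g}, (forall x y, y \in U -> br x y \in U) ->
    U = 0%VS \/ U = fullv.

(* Nilpotent self-normalizing subalgebras. *)
Definition cartan_subalgebra (h : {vspace g}) :=
  [/\ forall x y, x \in h -> y \in h -> br x y \in h,
      exists n, forall (s : n.-tuple g) y,
        {subset s <= h} -> y \in h -> foldr br y s = 0 &
      forall x, (forall y, y \in h -> br x y \in h) -> x \in h].

Variable h : {vspace g}.

Definition hdual : vectType K := 'Hom(subvs_of h, K^o).

Definition root_vector (b : hdual) (x : g) :=
  forall t : subvs_of h, br (vsval t) x = (b t : K) *: x.

Definition lie_root (b : hdual) :=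
  b != 0 /\ exists2 x, x != 0 & root_vector b x.

Definition root_base (I : finType) (a : I -> hdual) :=
  [/\ forall i, lie_root (a i), basis_of fullv (codom a) &
      forall b, lie_root b -> exists n : I -> nat,
        b = \sum_i a i *+ n i \/ b = - \sum_i a i *+ n i].

Definition positive_root (I : finType) (a : I -> hdual) (b : hdual) :=
  lie_root b /\ exists n : I -> nat, b = \sum_i a i *+ n i.

Definition invariant_form (f : g -> g -> K) :=
  [/\ forall y, linear (f^~ y : g -> K^o), forall x y, f x y = f y x,
      forall x y z, f (br x y) z = f x (br y z) &
      forall x, (forall y, f x y = 0) -> x = 0].

(* The form on [h^*] transported from the restriction of [f] to [h]. *)
Definition dual_form (f : g -> g -> K) (fd : hdual -> hdual -> K) :=
  forall (a b : hdual) (s t : subvs_of h),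
    (forall u : subvs_of h, f (vsval s) (vsval u) = a u) ->
    (forall u : subvs_of h, f (vsval t) (vsval u) = b u) ->
    fd a b = f (vsval s) (vsval t).

End LieAlgebra.

Record simple_lie_data (K : fieldType) := SimpleLieData {
  lie_alg : vectType K;
  bracket : lie_alg -> lie_alg -> lie_alg;
  bracketP : lie_bracket bracket;
  bracket_simple : simple_bracket bracket;
  cartan : {vspace lie_alg};
  cartanP : cartan_subalgebra bracket cartan;
  node : finType;
  sroot : node -> hdual cartan;
  srootP : root_base bracket sroot;
  lie_form : lie_alg -> lie_alg -> K;
  lie_formP : invariant_form bracket lie_form;
  form : hdual cartan -> hdual cartan -> K;
  formP : dual_form lie_form form;
  cartan_int : node -> node -> int;
  cartan_intP : forall i j,
    (cartan_int i j)%:~R =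
      2 * form (sroot i) (sroot j) / form (sroot i) (sroot i);
  dnat : node -> nat;
  dnatP : forall i, (dnat i)%:R = form (sroot i) (sroot i) / 2;
  dnat_range : forall i, dnat i \in [:: 1; 2; 3]%N;
  dnat_gcd : (\big[gcdn/0]_i dnat i)%N = 1%N;
  (* [rootvec true b] is $x_b^+$ and [rootvec false b] is $x_b^-$. *)
  rootvec : bool -> hdual cartan -> lie_alg;
  rootvecP : forall b, positive_root bracket sroot b ->
    [/\ root_vector bracket b (rootvec true b),
        root_vector bracket (- b) (rootvec false b) &
        lie_form (rootvec true b) (rootvec false b) = 1];
  fund_coweight : node -> subvs_of cartan;
  fund_coweightP : forall i j, sroot j (fund_coweight i) = (i == j)%:R
}.

Section Yangian.
Variables (K : fieldType) (L : simple_lie_data K).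
Local Notation I := (node L).

Definition dsym (i j : I) : K := form (sroot i) (sroot j) / 2.

(* [cartan_int i j <= 0] when [i != j], so this is $1 - c_{ij}$. *)
Definition serre_exp (i j : I) : nat := `|1 - cartan_int i j|%N.

(* [true] and [false] stand for the superscripts $+$ and $-$. *)
Definition sgn (s : bool) : K := if s then 1 else -1.

Inductive yangian_gen := YX of bool & I & nat | YXi of I & nat.
HB.instance Definition _ := gen_eqMixin yangian_gen.
HB.instance Definition _ := gen_choiceMixin yangian_gen.

Section Relations.
Let x s i n : free_alg K yangian_gen := free_gen K (YX s i n).
Let xi i n : free_alg K yangian_gen := free_gen K (YXi i n).

Inductive yangian_rel :
  free_alg K yangian_gen -> free_alg K yangian_gen -> Prop :=
| yangian_xi_xi i j m n : yangian_rel (comm (xi i m) (xi j n)) 0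
| yangian_xi0_x s i j n :
    yangian_rel (comm (xi i 0) (x s j n)) ((sgn s * (2 * dsym i j)) *: x s j n)
| yangian_xp_xm i j m n :
    yangian_rel (comm (x true i m) (x false j n))
                ((i == j)%:R *: xi i (m + n)%N)
| yangian_xi_x s i j m n :
    yangian_rel (comm (xi i m.+1) (x s j n) - comm (xi i m) (x s j n.+1))
                ((sgn s * dsym i j) *: acomm (xi i m) (x s j n))
| yangian_x_x s i j m n :
    yangian_rel (comm (x s i m.+1) (x s j n) - comm (x s i m) (x s j n.+1))
                ((sgn s * dsym i j) *: acomm (x s i m) (x s j n))
| yangian_serre s i j n of i != j :
    yangian_rel (iter (serre_exp i j) (comm (x s i 0)) (x s j n)) 0.

End Relations.

Definition yangian : assocAlgType K := pres_alg yangian_rel.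

Definition yx (s : bool) (i : I) (n : nat) : yangian :=
  alg_proj yangian_rel (free_gen K (YX s i n)).
Definition yxi (i : I) (n : nat) : yangian :=
  alg_proj yangian_rel (free_gen K (YXi i n)).

(* [DE i m] and [DF i m] stand for $E_i^{(m+1)}$ and $F_i^{(m+1)}$. *)
Inductive doubled_gen := DE of I & nat | DF of I & nat | DH of I & int.
HB.instance Definition _ := gen_eqMixin doubled_gen.
HB.instance Definition _ := gen_choiceMixin doubled_gen.

Section DoubledRelations.
Let E i n : free_alg K doubled_gen := free_gen K (DE i n).
Let F i n : free_alg K doubled_gen := free_gen K (DF i n).
Let H i p : free_alg K doubled_gen := free_gen K (DH i p).

Inductive doubled_rel :
  free_alg K doubled_gen -> free_alg K doubled_gen -> Prop :=
| doubled_H_H i j p q : doubled_rel (comm (H i p) (H j q)) 0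
| doubled_E_F i j m n :
    doubled_rel (comm (E i m) (F j n)) ((i == j)%:R *: H i (m + n).+1%N)
| doubled_H_E i j p m :
    doubled_rel (comm (H i (p + 1)) (E j m) - comm (H i p) (E j m.+1))
                (dsym i j *: acomm (H i p) (E j m))
| doubled_H_F i j p m :
    doubled_rel (comm (H i (p + 1)) (F j m) - comm (H i p) (F j m.+1))
                (- dsym i j *: acomm (H i p) (F j m))
| doubled_E_E i j m n :
    doubled_rel (comm (E i m.+1) (E j n) - comm (E i m) (E j n.+1))
                (dsym i j *: acomm (E i m) (E j n))
| doubled_F_F i j m n :
    doubled_rel (comm (F i m.+1) (F j n) - comm (F i m) (F j n.+1))
                (- dsym i j *: acomm (F i m) (F j n))
| doubled_serre_E i j m of i != j :
    doubled_rel (iter (serre_exp i j) (comm (E i 0)) (E j m)) 0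
| doubled_serre_F i j m of i != j :
    doubled_rel (iter (serre_exp i j) (comm (F i 0)) (F j m)) 0.

End DoubledRelations.

Definition doubled_yangian : assocAlgType K := pres_alg doubled_rel.

Definition doubled_elt (t : doubled_gen) : doubled_yangian :=
  alg_proj doubled_rel (free_gen K t).

(* $\mathbf Q^\vee$ is represented by coordinates in the basis of fundamental
   coweights, so that the pairing with simple roots is evaluation. *)
Definition coweight := {ffun I -> int}.

Definition coweight_val (mu : coweight) : subvs_of (cartan L) :=
  \sum_i fund_coweight i *~ mu i.

Definition fund (i : I) : coweight := [ffun j => (i == j)%:R].

Lemma sroot_coweight_val (mu : coweight) i :
  sroot i (coweight_val mu) = (mu i)%:~R.
Proof.
rewrite linear_sum (bigD1 i) //= big1 ?addr0 => [|j ji].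
  by rewrite raddfMz /= fund_coweightP eqxx.
by rewrite raddfMz /= fund_coweightP (negPf ji) mul0rz.
Qed.

Lemma coweight_val_fund i : coweight_val (fund i) = fund_coweight i.
Proof.
rewrite /coweight_val (bigD1 i) //= big1 ?addr0 => [|j ji].
  by rewrite ffunE eqxx.
by rewrite ffunE eq_sym (negPf ji).
Qed.

Inductive shifted_rel (mu : coweight) :
  doubled_yangian -> doubled_yangian -> Prop :=
| shifted_top i : shifted_rel mu (doubled_elt (DH i (- mu i))) aone
| shifted_below i p of (p < - mu i)%R :
    shifted_rel mu (doubled_elt (DH i p)) 0.

Definition shifted_yangian (mu : coweight) : assocAlgType K :=
  pres_alg (shifted_rel mu).

Definition shifted_proj (mu : coweight) :
  doubled_yangian -> shifted_yangian mu := alg_proj (shifted_rel mu).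

(* The coefficient of $u^{-p}$ in $\xi_i(u)$. *)
Definition yxi_coef (i : I) (p : int) : yangian :=
  match p with
  | Posz 0 => aone
  | Posz n.+1 => yxi i n
  | Negz _ => 0
  end.

Section Theta.
Variables (i : I) (l : K).

Definition theta_scal (j : I) : K :=
  if j == i then (l * (dnat i)%:R)^-1 else 1.

Definition theta_gen (t : doubled_gen) : yangian :=
  match t with
  | DE j m => yx true j m
  | DF j m => theta_scal j *: yx false j m
  | DH j p => theta_scal j *: yxi_coef j p
  end.

Definition theta : doubled_yangian -> yangian :=
  alg_lift (free_alg_lift theta_gen).

End Theta.
End Yangian.

Section YangianTheory.
Variables (K : fieldType) (L : simple_lie_data K).
Local Notation I := (node L).
Local Notation Y := (yangian L).
Implicit Types (i j : I) (m n : nat).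

Let pr := alg_proj (@yangian_rel K L).
Let prm : alg_morphism pr := alg_proj_morphism _.
Let prC := alg_morphism_comm prm.
Let prAC := alg_morphism_acomm prm.
Let prB := alg_morphismB prm.
Let prZ := alg_morphismZ prm.
Let pr0 := alg_morphism0 prm.
Let prI := alg_morphism_iter_comm prm.

Lemma yxi_xi i j m n : comm (yxi i m) (yxi j n) = 0 :> Y.
Proof.
by have := alg_proj_rel (yangian_xi_xi i j m n); rewrite -/pr [LHS]prC [RHS]pr0.
Qed.

Lemma yxi0_x s i j n :
  comm (yxi i 0) (yx s j n) = (sgn K s * (2 * dsym i j)) *: yx s j n :> Y.
Proof.
by have := alg_proj_rel (yangian_xi0_x s i j n); rewrite -/pr [LHS]prC [RHS]prZ.
Qed.

Lemma yxp_xm i j m n :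
  comm (yx true i m) (yx false j n) = (i == j)%:R *: yxi i (m + n)%N :> Y.
Proof.
by have := alg_proj_rel (yangian_xp_xm i j m n); rewrite -/pr [LHS]prC [RHS]prZ.
Qed.

Lemma yxi_x s i j m n :
  comm (yxi i m.+1) (yx s j n) - comm (yxi i m) (yx s j n.+1) =
  (sgn K s * dsym i j) *: acomm (yxi i m) (yx s j n) :> Y.
Proof.
have := alg_proj_rel (yangian_xi_x s i j m n).
rewrite -/pr [LHS]prB [RHS]prZ [X in X - _]prC [X in _ - X]prC.
by rewrite [X in _ *: X]prAC.
Qed.

Lemma yx_x s i j m n :
  comm (yx s i m.+1) (yx s j n) - comm (yx s i m) (yx s j n.+1) =
  (sgn K s * dsym i j) *: acomm (yx s i m) (yx s j n) :> Y.
Proof.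
have := alg_proj_rel (yangian_x_x s i j m n).
rewrite -/pr [LHS]prB [RHS]prZ [X in X - _]prC [X in _ - X]prC.
by rewrite [X in _ *: X]prAC.
Qed.

Lemma yserre s i j n : i != j ->
  iter (serre_exp i j) (comm (yx s i 0)) (yx s j n) = 0 :> Y.
Proof.
move=> h; have := alg_proj_rel (yangian_serre s n h).
by rewrite -/pr [LHS]prI [RHS]pr0.
Qed.

Lemma yxi_coef_comm i j p q : comm (yxi_coef i p) (yxi_coef j q) = 0 :> Y.
Proof.
case: p => [[|m]|m] /=; rewrite ?comm0l ?comm1l //.
case: q => [[|n]|n] /=; rewrite ?comm0r ?yxi_xi //.
by rewrite /comm amul1l amul1r subrr.
Qed.

Lemma yxi_coef_x s i j p n :
  comm (yxi_coef i (p + 1)) (yx s j n) - comm (yxi_coef i p) (yx s j n.+1) =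
  (sgn K s * dsym i j) *: acomm (yxi_coef i p) (yx s j n) :> Y.
Proof.
case: p => [[|m]|[|m]].
- rewrite /= comm1l subr0 yxi0_x /acomm amul1l amul1r -mulr2n -scaler_nat.
  by rewrite scalerA mulrAC [_ * 2]mulrC mulrCA mulrA.
- by rewrite -PoszD addn1 /= yxi_x.
- by rewrite /= comm1l comm0l subrr /acomm amul0l amul0r addr0 scaler0.
- have -> : Negz m.+1 + 1 = Negz m by rewrite !NegzE; lia.
  by rewrite /= !comm0l subrr /acomm amul0l amul0r addr0 scaler0.
Qed.

Variables (i0 : I) (l : K).

Let f := free_alg_lift (@theta_gen K L i0 l).
Let fm : alg_morphism f := free_alg_lift_morphism _.
Let fC := alg_morphism_comm fm.
Let fAC := alg_morphism_acomm fm.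
Let fI := alg_morphism_iter_comm fm.
Let fB := alg_morphismB fm.
Let fZ := alg_morphismZ fm.
Let f0 := alg_morphism0 fm.
Let fg t : f (free_gen K t) = theta_gen i0 l t.
Proof. exact: free_alg_liftE. Qed.

Fact theta_rel x y : @doubled_rel K L x y -> f x = f y.
Proof.
case=> [i j p q|i j m n|i j p m|i j p m|i j m n|i j m n|i j m ij|i j m ij].
- rewrite [LHS]fC [RHS]f0 !fg /= commZl commZr yxi_coef_comm.
  by rewrite !scaler0.
- rewrite [LHS]fC [RHS]fZ !fg /= commZr yxp_xm; case: eqVneq => [->|_].
    by rewrite !scale1r.
  by rewrite !scale0r scaler0.
- rewrite [LHS]fB [RHS]fZ [X in X - _]fC [X in _ - X]fC [X in _ *: X]fAC !fg /=.
  rewrite !commZl acommZl -scalerBr yxi_coef_x.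
  by rewrite mul1r !scalerA mulrC.
- rewrite [LHS]fB [RHS]fZ [X in X - _]fC [X in _ - X]fC [X in _ *: X]fAC !fg /=.
  rewrite !commZl !commZr acommZl acommZr.
  rewrite !scalerA -scalerBr yxi_coef_x mulN1r !scalerA; congr (_ *: _).
  ring.
- rewrite [LHS]fB [RHS]fZ [X in X - _]fC [X in _ - X]fC [X in _ *: X]fAC !fg /=.
  by rewrite yx_x mul1r.
- rewrite [LHS]fB [RHS]fZ [X in X - _]fC [X in _ - X]fC [X in _ *: X]fAC !fg /=.
  rewrite !commZl !commZr acommZl acommZr.
  rewrite !scalerA -scalerBr yx_x mulN1r !scalerA; congr (_ *: _).
  ring.
- by rewrite [LHS]fI [RHS]f0 !fg /= yserre.
- by rewrite [LHS]fI [RHS]f0 !fg /= iter_comm_scale yserre // scaler0.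
Qed.

Lemma theta_morphism : alg_morphism (theta i0 l : doubled_yangian L -> Y).
Proof. exact: alg_lift_morphism fm theta_rel. Qed.

Lemma theta_elt t : theta i0 l (doubled_elt t) = theta_gen i0 l t.
Proof. by rewrite [LHS](alg_liftE fm theta_rel) fg. Qed.

End YangianTheory.

(* Formal Laurent series in $u^{-1}$ are given by their coefficients: [s p] is
   the coefficient of $u^{-p}$.  [mul_u_add c s] is $(u + c) s(u)$. *)
Definition mul_u_add (K : fieldType) (V : lmodType K) (c : K) (s : int -> V)
  (p : int) : V := s (p + 1) + c *: s p.

Definition const_series (K : fieldType) (V : lmodType K) (v : V)
  (p : int) : V := if p == 0 then v else 0.

Section Modules.
Variables (K : fieldType) (L : simple_lie_data K).
Local Notation I := (node L).
Local Notation Y := (yangian L).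

(* [lie_emb] embeds the Lie algebra as the Lie subalgebra generated by the
   $x_{i,0}^\pm$; like [coproduct], it is determined by the equations below.
   The last sum ranges over a finite set. *)
Record drinfeld_coproduct := DrinfeldCoproduct {
  lie_emb : lie_alg L -> Y;
  lie_emb_linear : linear lie_emb;
  lie_emb_bracket : forall x y,
    lie_emb (bracket x y) = comm (lie_emb x) (lie_emb y);
  lie_emb_rootvec : forall s i, lie_emb (rootvec s (sroot i)) = yx s i 0;
  coproduct : Y -> tensor_alg Y Y;
  coproduct_morphism : alg_morphism coproduct;
  coproduct_x0 : forall s i,
    coproduct (yx s i 0) = tens (yx s i 0) aone + tens aone (yx s i 0);
  coproduct_xi0 : forall i,
    coproduct (yxi i 0) = tens (yxi i 0) aone + tens aone (yxi i 0);
  coproduct_xi1 : forall i,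
    coproduct (yxi i 1) =
      tens (yxi i 1) aone + tens aone (yxi i 1) + tens (yxi i 0) (yxi i 0)
      - \sum_(b \in [set b | positive_root (@bracket _ L) (@sroot _ L) b]
                     %classic)
          form b (sroot i) *: tens (lie_emb (rootvec false b))
                                   (lie_emb (rootvec true b))
}.

Definition tensor_module (D : drinfeld_coproduct) (V W : lmodType K)
    (actV : Y -> V -> V) (actW : Y -> W -> W) (y : Y) :
    tensor V W -> tensor V W :=
  tensor_act actV actW (coproduct D y).

Definition module_morphism (V W : lmodType K) (actV : Y -> V -> V)
    (actW : Y -> W -> W) (f : V -> W) :=
  linear f /\ forall y v, f (actV y v) = actW y (f v).

(* The identity for $\xi_i(u)$ is stated with the denominator cleared. *)
Definition highest_weight_vector (i : I) (k : nat) (x : K) (V : lmodType K)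
    (act : Y -> V -> V) (w : V) :=
  [/\ w != 0, forall j n, act (yx true j n) w = 0 &
      forall j p,
        if j == i then
          mul_u_add x (fun q => act (yxi_coef j q) w) p =
          mul_u_add (k%:R * (dnat i)%:R + x) (const_series w) p
        else act (yxi_coef j p) w = const_series w p].

Definition KR_module (i : I) (k : nat) (x : K) (V : vectType K)
    (act : Y -> V -> V) (w : V) :=
  [/\ is_repr act,
      forall U : {vspace V}, (forall y v, v \in U -> act y v \in U) ->
        U = 0%VS \/ U = fullv,
      forall U : {vspace V}, (forall y v, v \in U -> act y v \in U) ->
        w \in U -> U = fullv &
      highest_weight_vector i k x act w].

(* [KR Z l k] is $Z_{lk}$, hence [KR 0 l] is $W_{l,0}^{(i)}$; nothing is
   assumed when [k <= l]. *)
Record KR_system (D : drinfeld_coproduct) (i : I) := KRSystem {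
  KR : nat -> nat -> vectType K;
  KR_act : forall l k, Y -> KR l k -> KR l k;
  KR_vec : forall l k, KR l k;
  KR_P : forall l k, (l < k)%N ->
    KR_module i (k - l) (l%:R * (dnat i)%:R) (@KR_act l k) (KR_vec l k);
  KR_map : forall m l k, tensor (KR m l) (KR l k) -> KR m k;
  KR_map_morphism : forall m l k, (m < l)%N -> (l < k)%N ->
    module_morphism (tensor_module D (@KR_act m l) (@KR_act l k))
      (@KR_act m k) (@KR_map m l k);
  KR_map_vec : forall m l k, (m < l)%N -> (l < k)%N ->
    KR_map (tens (KR_vec m l) (KR_vec l k)) = KR_vec m k;
  KR_map_inj : forall l k, (0 < l)%N -> (l < k)%N ->
    injective (fun v : KR 0 l => KR_map (tens v (KR_vec l k)));
  KR_map_comp : forall m l k, (0 < m)%N -> (m < l)%N -> (l < k)%N ->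
    forall v : KR 0 m,
      KR_map (tens (KR_map (tens v (KR_vec m l))) (KR_vec l k)) =
      KR_map (tens v (KR_vec m k))
}.

Section InductiveSystem.
Variables (D : drinfeld_coproduct) (i : I) (S : KR_system D i).

(* [KR_F l k] is $F_{k,l}$. *)
Definition KR_F (l k : nat) (v : KR S 0 l) : KR S 0 k :=
  KR_map (tens v (KR_vec S l k)).

Definition W_inf : lmodType K :=
  dirlim (W := fun n => KR S 0 n.+1) (fun m n => @KR_F m.+1 n.+1).

Definition W_inf_in (n : nat) : KR S 0 n.+1 -> W_inf :=
  @dirlim_in K (fun n => KR S 0 n.+1) (fun m n => @KR_F m.+1 n.+1) n.

Definition coefficient_maps (t : doubled_gen L) (l : nat)
    (C C' : KR S 0 l -> KR S 0 l.+1) :=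
  [/\ linear C, linear C' &
      forall k (v : KR S 0 l), (l.+1 < k)%N ->
        KR_act (theta i k%:R (doubled_elt t)) (KR_F k v) =
        KR_F k (C v + (k%:R * (dnat i)%:R)^-1 *: C' v)].

End InductiveSystem.

(* For a series $f(u) = \sum_{s \ge 0} f_s u^{-(p_0+s)}$, the coefficient of
   $u^{-(p_0+n)}$ in $f(u+x)$, where
   $(u+x)^{-p} = \sum_r \binom{-p}{r} x^r u^{-p-r}$. *)
Definition shift_coef (V : lmodType K) (x : K) (p0 : int) (f : nat -> V)
    (n : nat) : V :=
  \sum_(s < n.+1)
    ((\prod_(r < n - s) (- (p0 + s%:Z) - r%:Z)%:~R) / (n - s)`!%:R
       * x ^+ (n - s)) *: f s.

Definition shifted_elt (mu : coweight L) (t : doubled_gen L) :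
  shifted_yangian mu := shifted_proj mu (doubled_elt t).

Definition spectral_shift (mu : coweight L) (x : K)
    (tau : shifted_yangian mu -> shifted_yangian mu) :=
  [/\ alg_morphism tau, bijective tau &
      forall i n,
        [/\ tau (shifted_elt mu (DE i n)) =
              shift_coef x 1 (fun s => shifted_elt mu (DE i s)) n,
            tau (shifted_elt mu (DF i n)) =
              shift_coef x 1 (fun s => shifted_elt mu (DF i s)) n &
            tau (shifted_elt mu (DH i (- mu i + n%:Z))) =
              shift_coef x (- mu i)
                (fun s => shifted_elt mu (DH i (- mu i + s%:Z))) n]].

End Modules.

(* Main.v *)
Require Import Defs.
From mathcomp Require Import all_boot all_order all_algebra.
From mathcomp Require Import reals complex.
From mathcomp Require Import monalg.

Import GRing.Theory Num.Theory.
Local Open Scope ring_scope.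

(** The pairing of [- fund i] with a simple root $\alpha_j$ is $-\delta_{ij}$,
    so the representation factorizes as soon as $H_j^{(\delta_{ij})}$ acts on
    the inductive limit as the identity and $H_j^{(p)}$ acts as zero for
    $p < \delta_{ij}$.

    The action of a generator is the constant term of an expression that is
    affine in $(k d_i)^{-1}$.  Because the transition maps are injective and
    the numbers $(k d_i)^{-1}$ are distinct, this constant term can be read off
    from any formula of that shape ([coefficient_mapsE]).  Such a formula is
    immediate when $\xi_j(u)$ contributes a scalar: for $p < 0$ the action is
    zero, for $p = 0$ and $j \neq i$ it is the identity, and for $p = 0$ and
    $j = i$ it is $(k d_i)^{-1}$ times the identity, with constant term zero.

    The remaining case, $H_i^{(1)}$, is the only one that involves the
    coproduct.  It acts as $(k d_i)^{-1} \xi_{i,0}$; since $\xi_{i,0}$ is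
    primitive and $\omega_{lk}$ has weight $(k - l) d_i$,
    $$(k d_i)^{-1} \xi_{i,0} F_{k,l}(v)
        = F_{k,l}(v + (k d_i)^{-1} (\xi_{i,0} v - l d_i v)),$$
    with constant term $v$ ([KR_F_xi0], [coefficient_mapH_top]).  The weight of
    the tensor factor grows linearly in $k$, and this growth exactly cancels
    the normalization of [theta]. *)

(** * Representations of quotient algebras and maps out of direct limits *)

(** The elements that act as zero form a two-sided ideal. *)
Lemma pres_alg_repr (K : fieldType) (A : assocAlgType K) (Rel : A -> A -> Prop)
    (V : lmodType K) (act : A -> V -> V) :
  is_repr act -> (forall l r, Rel l r -> act l =1 act r) ->
  exists act' : pres_alg Rel -> V -> V,
    is_repr act' /\ forall a, act a =1 act' (alg_proj Rel a).
Proof.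
move=> [actPl actPr act1 actM] actR.
have act_ideal x : rel_ideal Rel x -> forall v, act x v = 0.
  elim=> {x} [l r lr v | v | a x y _ hx _ hy v | x y _ hy v | x y _ hx v].
  - by rewrite (zmod_morphism_linear (actPl v)) (actR l r lr) subrr.
  - exact: linear_at0 (actPl v).
  - by rewrite actPl hx hy scaler0 addr0.
  - by rewrite actM hy; apply: linear_at0 (actPr x).
  - by rewrite actM hx.
pose rp : pres_alg Rel -> A := @aq_repr _ _ _ (pres_alg_quotient Rel).
have actE a v : act a v = act (rp (alg_proj Rel a)) v.
  have /act_ideal/(_ v) : rel_ideal Rel (a - rp (alg_proj Rel a)).
    apply/(aq_ker (pres_alg_quotient Rel)).
    by rewrite -/(alg_proj Rel) linearB /= alg_reprK subrr.
  by rewrite (zmod_morphism_linear (actPl v)) => /eqP; rewrite subr_eq0 => /eqP.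
exists (fun q => act (rp q)); split; last exact: actE.
split=> [v a x y | q | v | x y v].
- by rewrite -[x]alg_reprK -[y]alg_reprK -linearP -!actE actPl.
- exact: actPr.
- by rewrite -(alg_proj1 Rel) -actE.
- by rewrite -[x]alg_reprK -[y]alg_reprK -alg_projM -!actE actM.
Qed.

Lemma repr_comp (K : fieldType) (A B : assocAlgType K) (V : lmodType K)
    (f : A -> B) (act : B -> V -> V) :
  alg_morphism f -> is_repr act -> is_repr (fun x => act (f x)).
Proof.
move=> [fP f1 fM] [actPl actPr act1 actM]; split=> [v a x y | x | v | x y v].
- by rewrite fP actPl.
- exact: actPr.
- by rewrite f1 act1.
- by rewrite fM actM.
Qed.

(** The images of the terms of the system span the limit. *)
Lemma dirlim_eq_linear (K : fieldType) (W : nat -> lmodType K)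
    (f : forall m n, W m -> W n) (V : lmodType K) (g h : dirlim f -> V) :
  linear g -> linear h ->
  (forall n (w : W n), g (dirlim_in f w) = h (dirlim_in f w)) -> g =1 h.
Proof.
move=> gP hP gh q; rewrite -[q]pres_reprK [mq_repr q]monalgE linear_sum.
elim/big_rec: _ => [|[n w] x _ ih]; first by rewrite !linear_at0.
set c := _@_ _; set w' := existT _ n w.
have -> : << c *g w' >> = c *: << w' >> :> {malg K[_]}.
  by apply/malgP => k; rewrite mcoeffZ !mcoeffU mulrnAr mulr1.
by rewrite linearZ /= gP hP ih; congr (_ *: _ + _); exact: gh.
Qed.

(** * Constant terms of affine expressions in an inverse *)

(** Multiplying either equation by its $n c$ shows that $n c (a - a')$ takes
    the same value $b' - b$ at $n = k$ and at $n = k'$. *)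
Lemma affine_in_inv_eq (K : numFieldType) (V : lmodType K) (c : K)
    (k k' : nat) (a a' b b' : V) :
  c != 0 -> (0 < k)%N -> (0 < k')%N -> k != k' ->
  a + (k%:R * c)^-1 *: b = a' + (k%:R * c)^-1 *: b' ->
  a + (k'%:R * c)^-1 *: b = a' + (k'%:R * c)^-1 *: b' -> a = a'.
Proof.
move=> c0 k0 k'0 kk'.
have scaled n : (0 < n)%N ->
    a + (n%:R * c)^-1 *: b = a' + (n%:R * c)^-1 *: b' ->
    (n%:R * c) *: (a - a') = b' - b.
  move=> n0 e.
  have nc0 : n%:R * c != 0 by rewrite mulf_neq0 // pnatr_eq0 -lt0n.
  have -> : a - a' = (n%:R * c)^-1 *: (b' - b).
    by apply/eqP; rewrite scalerBr subr_eq addrAC eq_sym subr_eq e addrC.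
  by rewrite scalerA divff // scale1r.
move=> /(scaled _ k0) ek /(scaled _ k'0) ek'; apply/eqP.
have /eqP : (k%:R * c) *: (a - a') - (k'%:R * c) *: (a - a') = 0.
  by rewrite ek ek' subrr.
rewrite -scalerBl -mulrBl scaler_eq0 mulf_eq0 (negPf c0) orbF.
by rewrite subr_eq0 eqr_nat (negPf kk') subr_eq0.
Qed.

(** * The Cartan generators on Kirillov-Reshetikhin modules *)

Section KRSystem.
Context {K : numFieldType} {L : simple_lie_data K} {D : drinfeld_coproduct L}.
Context {i : node L} {S : KR_system D i}.
Implicit Types (j : node L) (l k : nat).

Lemma dnat_neq0 j : (dnat j)%:R != 0 :> K.
Proof. by rewrite pnatr_eq0; have := dnat_range j; case: dnat. Qed.

Lemma KR_F_linear l k : (0 < l)%N -> (l < k)%N -> linear (@KR_F _ _ _ _ S l k).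
Proof.
move=> l0 lk a v w.
by rewrite /KR_F tensPl; have [-> _] := KR_map_morphism S l0 lk.
Qed.

Lemma KR_F_inj l k :
  (0 < l)%N -> (l < k)%N -> injective (@KR_F _ _ _ _ S l k).
Proof. exact: KR_map_inj. Qed.

(** This is the coefficient of $u^0$ in the identity
    $(u + x) \xi_i(u) \omega = (u + k d_i + x) \omega$. *)
Lemma highest_weight_xi0 k x (V : lmodType K) (act : yangian L -> V -> V) w :
  is_repr act -> highest_weight_vector i k x act w ->
  act (yxi i 0) w = (k%:R * (dnat i)%:R) *: w.
Proof.
move=> [_ _ act1 _] [_ _ /(_ i 0)]; rewrite eqxx /mul_u_add /const_series /=.
by rewrite act1 add0r scalerDl => /addIr.
Qed.

(** The element $\xi_{i,0}$ is primitive, and $\omega_{lk}$ is an eigenvector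
    for it. *)
Lemma KR_F_xi0 l k (v : KR S 0 l) : (0 < l)%N -> (l < k)%N ->
  KR_act (yxi i 0) (KR_F k v) =
  KR_F k (KR_act (yxi i 0) v + ((k - l)%:R * (dnat i)%:R) *: v).
Proof.
move=> l0 lk; have [_ mact] := KR_map_morphism S l0 lk.
have [[lPl lPr l1 _] _ _ _] := KR_P S l0.
have [reprk _ _ hwk] := KR_P S lk; have [kPl kPr k1 _] := reprk.
rewrite /KR_F -mact /tensor_module coproduct_xi0; congr (KR_map _).
rewrite -[X in X + _]scale1r tensor_actPl // scale1r !tensor_actE // l1 k1.
rewrite (highest_weight_xi0 _ _ _ _ _ reprk hwk).
rewrite [_ + _ *: v]addrC tensPl addrC; congr (_ + _).
exact: (scalable_linear (tensPr v)).
Qed.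

(** Comparing the two expansions at $k = l + 2$ and $k = l + 3$ determines the
    constant term. *)
Lemma coefficient_mapsE t l (C C' : KR S 0 l -> KR S 0 l.+1) v a b :
  (0 < l)%N -> coefficient_maps t C C' ->
  (forall k, (l.+1 < k)%N ->
     KR_act (theta i k%:R (doubled_elt t)) (KR_F k v) =
     KR_F k (a + (k%:R * (dnat i)%:R)^-1 *: b)) ->
  C v = a.
Proof.
move=> l0 [_ _ CE] ab.
have eqk k : (l.+1 < k)%N -> C v + (k%:R * (dnat i)%:R)^-1 *: C' v =
                             a + (k%:R * (dnat i)%:R)^-1 *: b.
  by move=> lk; apply: (KR_F_inj _ _ (ltn0Sn l) lk); rewrite -CE // ab.
apply: (affine_in_inv_eq _ _ _ l.+2 l.+3 _ _ _ _ (dnat_neq0 i) _ _ _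
  (eqk _ _) (eqk _ _)) => //.
by rewrite neq_ltn ltnSn.
Qed.

Lemma theta_H c j p :
  theta i c (doubled_elt (DH j p)) =
  (if j == i then (c * (dnat i)%:R)^-1 else 1) *: yxi_coef j p.
Proof. by rewrite theta_elt. Qed.

(** For $j = i$ the weight $(k - l) d_i$ of $\omega_{lk}$, multiplied by
    $(k d_i)^{-1}$, has constant term $1$; the part $- l d_i$ goes into the
    coefficient of $(k d_i)^{-1}$. *)
Lemma coefficient_mapH_top j l (C C' : KR S 0 l -> KR S 0 l.+1) v :
  (0 < l)%N -> coefficient_maps (DH j (i == j)%:R) C C' -> C v = KR_F l.+1 v.
Proof.
move=> l0 CP.
apply: (coefficient_mapsE _ _ _ _ _ _
  (if j == i then KR_F l.+1 (KR_act (yxi i 0) v - (l%:R * (dnat i)%:R) *: v)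
   else 0) l0 CP) => k lk.
have lk' : (l < k)%N by apply: ltn_trans lk.
have [[actPl _ act1 _] _ _ _] := KR_P S (ltn_trans l0 lk').
rewrite theta_H; case: (eqVneq j i) => [->|_] /=; last first.
  by rewrite scale1r act1 scaler0 addr0 [RHS]KR_map_comp.
rewrite (scalable_linear (actPl _)) KR_F_xi0 //.
rewrite [in RHS]addrC -(KR_F_linear _ _ l0 (ltnSn l)) [RHS]KR_map_comp //.
rewrite -[LHS](scalable_linear (KR_F_linear _ _ l0 lk')); congr (KR_F k _).
have kd0 : k%:R * (dnat i)%:R != 0 :> K.
  by rewrite mulf_neq0 ?dnat_neq0 // pnatr_eq0 -lt0n (ltn_trans l0).
rewrite natrB 1?ltnW // mulrBl scalerBl addrCA scalerDr scalerA mulVf //.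
by rewrite scale1r [LHS]addrC.
Qed.

(** A nonzero action occurs only for $p = 0$ and $j = i$, and there it is the
    pure $(k d_i)^{-1}$ term. *)
Lemma coefficient_mapH_below j p l (C C' : KR S 0 l -> KR S 0 l.+1) v :
  (0 < l)%N -> p < (i == j)%:R -> coefficient_maps (DH j p) C C' -> C v = 0.
Proof.
move=> l0 pj CP.
apply: (coefficient_mapsE _ _ _ _ _ _
  (if p == 0 then KR_F l.+1 v else 0) l0 CP) => k lk.
have lk' : (l < k)%N by apply: ltn_trans lk.
have [[actPl _ act1 _] _ _ _] := KR_P S (ltn_trans l0 lk').
have FP := KR_F_linear _ _ (ltn0Sn l) lk.
rewrite theta_H add0r; case: p pj {CP} => [[|p]|p]; last first.
- by rewrite /= !scaler0 (linear_at0 (actPl _)) (linear_at0 FP).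
- by case: eqP.
case: (eqVneq j i) => // _ _ /=.
rewrite (scalable_linear (actPl _)) act1 [RHS](scalable_linear FP).
by rewrite [X in _ = _ *: X]KR_map_comp.
Qed.

End KRSystem.

(** * Factorization through the shifted Yangian *)

Theorem proposition23 (R : realType) (L : simple_lie_data R[i])
    (D : drinfeld_coproduct L) (i : node L) (S : KR_system D i)
    (C C' : doubled_gen L -> forall l : nat, KR S 0 l -> KR S 0 l.+1)
    (hC : forall (t : doubled_gen L) (l : nat), (0 < l)%N ->
      coefficient_maps t (C t l) (C' t l))
    (rho : doubled_yangian L -> W_inf S -> W_inf S)
    (rho_repr : is_repr rho)
    (rho_gen : forall (t : doubled_gen L) (n : nat) (v : KR S 0 n.+1),
      rho (doubled_elt t) (W_inf_in v) = W_inf_in (C t n.+1 v)) :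
  exists rho' : shifted_yangian (- fund i) -> W_inf S -> W_inf S,
    [/\ is_repr rho',
        forall (a : doubled_yangian L) (v : W_inf S),
          rho a v = rho' (shifted_proj (- fund i) a) v &
        forall (x : R[i]) (tau : shifted_yangian (- fund i) ->
                                 shifted_yangian (- fund i)),
          spectral_shift x tau -> is_repr (fun y => rho' (tau y))].
Proof.
have [rhoPl rhoPr rho1 _] := rho_repr.
have fundE j : - (- fund i) j = (i == j)%:R by rewrite /fund !ffunE opprK.
have rho_rel a b : shifted_rel (- fund i) a b -> rho a =1 rho b.
  case=> [j | j p]; rewrite fundE; last move=> pj;
    apply: (dirlim_eq_linear _ _ _ _ _ _ (rhoPr _) (rhoPr _)) => n v;
    rewrite [LHS]rho_gen.
  - rewrite (coefficient_mapH_top _ _ _ _ _ _ (hC _ _ (ltn0Sn n))) // rho1.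
    exact: dirlim_in_transition (ltnSn n).
  - rewrite (coefficient_mapH_below _ _ _ _ _ _ _ pj (hC _ _ (ltn0Sn n))) //.
    rewrite (linear_at0 (rhoPl _)).
    exact: linear_at0 (@dirlim_in_linear _ _ _ _).
have [rho' [rho'P rhoE]] := pres_alg_repr _ _ _ _ _ rho_repr rho_rel.
exists rho'; split=> // x tau [tauP _ _].
exact: repr_comp tauP rho'P.
Qed.
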